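(* Let $d\ge 0$ be an integer, let $G$ be a graph on $n$ vertices and let $A$ be a real symmetric matrix with rows and columns indexed by $V(G)$ such that $|A_{u,v}|\le 1$ for all $u,v$, and $A_{u,v}=0$ whenever $u\not\sim v$ (in particular $A_{u,u}=0$). Then $$\alpha^d(G)\le\min\{\,n-n_d^+(A),\ n-n_d^-(A)\,\}.$$
   Context: Graphs are finite and simple. $\alpha^d(G)$ denotes the maximum number of vertices of an induced subgraph of $G$ with maximum degree at most $d$. $n_d^+(A)$ is the number of eigenvalues of $A$ (counted with multiplicity) that are strictly greater than $d$, and $n_d^-(A)$ is the number of eigenvalues of $A$ (counted with multiplicity) that are strictly smaller than $-d$. *)

(* Defs.v *)
(* Mathematical Components; the reals are an arbitrary realType. *)
From HB Require Import structures.
From mathcomp Require Export all_boot all_order all_algebra.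
From mathcomp Require Export reals polyrcf.

Set Implicit Arguments.
Unset Strict Implicit.
Unset Printing Implicit Defensive.

Import Order.TTheory GRing.Theory Num.Theory.
Local Open Scope ring_scope.

(* A simple graph is a symmetric irreflexive relation e on a finType V. *)
Section Graph.
Variables (V : finType) (e : rel V).

Definition induced_degree (S : {set V}) (u : V) : nat :=
  #|[set v in S | e u v]|.

Definition induced_max_degree (S : {set V}) : nat :=
  \max_(u in S) induced_degree S u.

Definition alpha (d : nat) : nat :=
  \max_(S : {set V} | (induced_max_degree S <= d)%N) #|S|.

End Graph.

Section Eigenvalues.
Variables (R : realType) (m : nat).
Implicit Type A : 'M[R]_m.

Definition spectrum A : seq R := rootsR (char_poly A).

Lemma spectrum_uniq A : uniq (spectrum A).
Proof. exact: uniq_roots. Qed.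

Lemma mem_spectrum A x : (x \in spectrum A) = eigenvalue A x.
Proof.
have A0 : char_poly A != 0 by rewrite monic_neq0 ?char_poly_monic.
by rewrite eigenvalue_root_char -(roots_on_rootsR A0) in_itv.
Qed.

(* Multiplicities are algebraic; for symmetric A these are also the dimensions
   of the eigenspaces. *)
Definition num_eig_gt (d : nat) A : nat :=
  \sum_(x <- spectrum A | d%:R < x) mup x (char_poly A).

Definition num_eig_ltN (d : nat) A : nat :=
  \sum_(x <- spectrum A | x < - d%:R) mup x (char_poly A).

End Eigenvalues.

(* Main.v *)
Require Import Defs.
From mathcomp Require Import spectral complex sesquilinear.

(** Inertia against a quadratic form bound.  Let S be a vertex set inducing a
    subgraph of maximum degree at most d.  If x is supported on S, the quadratic
    form of A at x is a sum of terms x u * A u v * (x v)^* with u, v in S adjacent;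
    since the entries of A are at most 1 in modulus, |x u| |x v| <=
    (|x u|^2 + |x v|^2) / 2 bounds its modulus by d |x|^2
    ([hform_norm_le]).  On the other hand the form exceeds d |x|^2 at every
    nonzero x in the span W of the eigenvectors for the eigenvalues > d.  So W
    meets the |S|-dimensional space of vectors supported on S trivially, whence
    dim W + |S| <= n ([card_big_eigenvalues_le]).  The bound on the modulus is
    the same for - A, which turns eigenvalues < - d into eigenvalues > d.

    The algebraic multiplicities are related to dim W by the spectral theorem:
    A is diagonalised by a unitary matrix with real diagonal entries
    ([real_symmetric_diagonalization]), and the multiplicity of x in the
    characteristic polynomial counts the entries equal to x
    ([sum_mup_spectrum]).  The eigenvectors are taken over R[i], where A is a
    normal matrix; the estimates are therefore made for sesquilinear forms. *)

Set Implicit Arguments.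
Unset Strict Implicit.
Unset Printing Implicit Defensive.
Import Order.TTheory GRing.Theory Num.Theory.
Local Open Scope ring_scope.
Local Open Scope sesquilinear_scope.

(** * Quadratic forms over the complex numbers *)

Section QuadraticForm.
Variable C : numClosedFieldType.

Definition hform n (B : 'M[C]_n) (x : 'rV[C]_n) : C := (x *m B *m x ^t* ) 0 0.

Lemma hformE n (B : 'M[C]_n) x :
  hform B x = \sum_i \sum_j x 0 i * B i j * (x 0 j)^*.
Proof.
rewrite exchange_big /hform mxE; apply: eq_bigr => j _.
by rewrite !mxE mulr_suml.
Qed.

Lemma hform_diag n (r x : 'rV[C]_n) :
  hform (diag_mx r) x = \sum_i r 0 i * `|x 0 i| ^+ 2.
Proof.
rewrite hformE; apply: eq_bigr => i _; rewrite (bigD1 i) //= big1 => [|j ne_ji].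
  by rewrite addr0 mxE eqxx mulr1n normCK mulrCA mulrA.
by rewrite mxE eq_sym (negPf ne_ji) mulr0n mulr0 mul0r.
Qed.

Lemma hform1 n (x : 'rV[C]_n) : hform 1%:M x = \sum_i `|x 0 i| ^+ 2.
Proof.
rewrite -diag_const_mx hform_diag; apply: eq_bigr => i _.
by rewrite mxE mul1r.
Qed.

Lemma hformN n (B : 'M[C]_n) x : hform (- B) x = - hform B x.
Proof. by rewrite /hform mulmxN mulNmx mxE. Qed.

Lemma hform_congr n (P B : 'M[C]_n) x :
  hform (P ^t* *m B *m P) (x *m P) = hform (P *m P ^t* *m B *m (P *m P ^t* )) x.
Proof. by rewrite /hform trmx_mul map_mxM !mulmxA. Qed.

(** AM-GM, and then double counting: each |x i|^2 receives half a unit from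
    every pair (i, j) and every pair (j, i) inside S with a nonzero entry, thus
    at most d in total.  Bounding the modulus, which does not change from B to
    - B, serves both ends of the spectrum. *)
Lemma hform_norm_le n (B : 'M[C]_n) (S : {set 'I_n}) (d : nat) (x : 'rV[C]_n) :
    (forall i j, B j i = B i j) -> (forall i j, `|B i j| <= 1) ->
    (forall i, i \in S -> (#|[set j in S | B i j != 0%R]| <= d)%N) ->
    (forall i, i \notin S -> x 0 i = 0) ->
  `|hform B x| <= d%:R * hform 1%:M x.
Proof.
move=> Bsym Ble1 degB xS.
(* The symmetric 0-1 weight of the pairs that contribute to the form. *)
pose w i j : C := [&& i \in S, j \in S & B i j != 0]%:R.
have wC i j : w j i = w i j by rewrite /w Bsym andbCA.
have term i j : `|x 0 i * B i j * (x 0 j)^*| <=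
    w i j * (`|x 0 i| ^+ 2 / 2 + `|x 0 j| ^+ 2 / 2).
  rewrite /w; case: (boolP [&& _, _ & _]) => [_|]; last first.
    rewrite !negb_and negbK => /or3P[/xS->|/xS->|/eqP->];
      by rewrite ?(conjC0, mul0r, mulr0) normr0.
  rewrite mul1r !normrM norm_conjC.
  apply: (@le_trans _ _ (`|x 0 i| * `|x 0 j|)).
    by rewrite ler_wpM2r // ler_piMr.
  have : 0 <= (`|x 0 i| - `|x 0 j|) ^+ 2 by rewrite -realEsqr rpredB ?normr_real.
  rewrite sqrrB addrAC subr_ge0 => AGM.
  by rewrite -(ler_pM2r (ltr0n C 2)) mulrDl !divfK ?pnatr_eq0 // mulr_natr.
have half_sum : \sum_i \sum_j w i j * (`|x 0 j| ^+ 2 / 2) =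
    \sum_i \sum_j w i j * (`|x 0 i| ^+ 2 / 2).
  rewrite exchange_big; apply: eq_bigr => i _; apply: eq_bigr => j _.
  by rewrite wC.
rewrite hformE hform1 mulr_sumr.
apply: (@le_trans _ _ (\sum_i \sum_j w i j * (`|x 0 i| ^+ 2))).
  have ->: \sum_i \sum_j w i j * `|x 0 i| ^+ 2 =
      \sum_i \sum_j w i j * (`|x 0 i| ^+ 2 / 2 + `|x 0 j| ^+ 2 / 2).
    under [RHS]eq_bigr do under eq_bigr do rewrite mulrDr.
    under [RHS]eq_bigr do rewrite big_split.
    rewrite big_split /= half_sum -big_split; apply: eq_bigr => i _ /=.
    rewrite -big_split; apply: eq_bigr => j _ /=.
    by rewrite -mulrDr -splitr.
  apply: le_trans (ler_norm_sum _ _ _) (ler_sum _ _) => i _.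
  exact: le_trans (ler_norm_sum _ _ _) (ler_sum _ _).
apply: ler_sum => i _; rewrite -mulr_suml.
have [iS|/xS->] := boolP (i \in S); last by rewrite normr0 expr0n !mulr0.
apply: ler_wpM2r; first by rewrite exprn_ge0.
rewrite -natr_sum ler_nat; apply: leq_trans (degB i iS).
rewrite -sum1_card [leqRHS]big_mkcond; apply: leq_sum => j _.
by rewrite inE iS; case: ifP.
Qed.

End QuadraticForm.

(** * Dimension count *)

(** The combinations of the rows indexed by K have |K| free coefficients, and
    vanishing off S imposes n - |S| < |K| linear equations on them. *)
Lemma exists_supported_comb (F : fieldType) m n (P : 'M[F]_(m, n))
    (K : {set 'I_m}) (S : {set 'I_n}) : (n < #|K| + #|S|)%N ->
  exists y : 'rV[F]_m, [/\ y != 0, forall i, i \notin K -> y 0 i = 0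
    & forall j, j \notin S -> (y *m P) 0 j = 0].
Proof.
move=> ltn; pose f (k : 'I_#|K|) : 'I_m := enum_val k.
pose g (k : 'I_#|~: S|) : 'I_n := enum_val k.
pose N := colsub g (rowsub f P).
have : kermx N != 0.
  rewrite kermx_eq0 -row_leq_rank -ltnNge.
  apply: leq_ltn_trans (rank_leq_col _) _.
  by move: ltn; rewrite -[X in (X < _)%N](card_ord n) -(cardsC S) addnC ltn_add2r.
case/rowV0Pn => a /sub_kermxP aN0 a_neq0.
pose y : 'rV[F]_m := a *m rowsub f 1%:M.
have yP : y *m P = a *m rowsub f P by rewrite /y -mulmxA mul_rowsub_mx mul1mx.
exists y; split.
- apply: contraNneq a_neq0 => y0; apply/eqP/rowP => k.
  have /rowP/(_ (f k)) := y0; rewrite !mxE => <-.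
  rewrite (bigD1 k) //= big1 => [|l ne_lk]; first by rewrite !mxE eqxx mulr1 addr0.
  by rewrite !mxE (inj_eq enum_val_inj) (negPf ne_lk) mulr0.
- move=> i iK; rewrite mxE big1 // => k _; rewrite !mxE.
  have [fk|] := eqVneq; last by rewrite mulr0.
  by rewrite -fk enum_valP in iK.
move=> j jS; have jS' : j \in ~: S by rewrite inE.
have /rowP/(_ (enum_rank_in jS' j)) := aN0; rewrite yP !mxE; apply: etrans.
by apply: eq_bigr => k _; rewrite !mxE /g enum_rankK_in.
Qed.

(** The rows of P are orthonormal eigenvectors of B.  If there were too many
    indices, some nonzero combination y *m P of the rows in K would be supported
    on S; in the coordinates y its form is the sum of the r i |y i|^2 over K,
    strictly larger than c |y|^2. *)
Lemma card_big_eigenvalues_le (C : numClosedFieldType) n (P B : 'M[C]_n)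
    (r : 'rV[C]_n) (c : C) (K S : {set 'I_n}) :
    P \is unitarymx -> B = P ^t* *m diag_mx r *m P -> 0 <= c ->
    (forall i, i \in K -> c < r 0 i) ->
    (forall x : 'rV[C]_n, (forall i, i \notin S -> x 0 i = 0) ->
       `|hform B x| <= c * hform 1%:M x) ->
  (#|K| + #|S| <= n)%N.
Proof.
move=> /unitarymxP PP defB c_ge0 cK boundB; rewrite leqNgt; apply/negP.
case/(exists_supported_comb P) => y [y_neq0 yK /boundB].
have -> : hform 1%:M (y *m P) = hform 1%:M y.
  by rewrite /hform trmx_mul map_mxM !mulmx1 mulmxA -(mulmxA y) PP mulmx1.
rewrite defB hform_congr PP mul1mx mulmx1 hform_diag hform1 mulr_sumr.
have le_term i : c * `|y 0 i| ^+ 2 <= r 0 i * `|y 0 i| ^+ 2.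
  have [/cK/ltW cr|/yK->] := boolP (i \in K); last by rewrite normr0 expr0n !mulr0.
  by rewrite ler_wpM2r // exprn_ge0.
rewrite ger0_norm; last first.
  by apply: sumr_ge0 => i _; apply: le_trans (le_term i); rewrite mulr_ge0 ?exprn_ge0.
have [i yi_neq0] : exists i, y 0 i != 0.
  apply/existsP; apply: contraNT y_neq0; rewrite negb_exists => /forallP y0.
  by apply/eqP/rowP => i; rewrite mxE; apply/eqP; have := y0 i; rewrite negbK.
have iK : i \in K by apply: contraNT yi_neq0 => /yK->.
rewrite (bigD1 i) // [leRHS](bigD1 i) //=; apply/negP; rewrite lt_geF //.
rewrite ltr_leD ?ltr_pM2r ?exprn_gt0 ?normr_gt0 ?cK //.
by apply: ler_sum => j _; apply: le_term.
Qed.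

(** * Spectrum of a real symmetric matrix *)

Lemma char_poly_similar (R : comUnitRingType) n (P D : 'M[R]_n) :
  P \in unitmx -> char_poly (invmx P *m D *m P) = char_poly D.
Proof.
move=> Pu; rewrite /char_poly.
have -> : char_poly_mx (invmx P *m D *m P) =
    map_mx polyC (invmx P) *m char_poly_mx D *m map_mx polyC P.
  rewrite /char_poly_mx mulmxBr mulmxBl !map_mxM; congr (_ - _).
  by rewrite mul_mx_scalar -scalemxAl -map_mxM mulVmx // map_mx1 scalemx1.
rewrite !det_mulmx mulrC mulrA -det_mulmx -map_mxM mulmxV //.
by rewrite map_mx1 det1 mul1r.
Qed.

Section RealSymmetric.
Variables (R : realType) (n : nat) (A : 'M[R]_n).

(** The factorisation of the characteristic polynomial holds over R[i] by
    similarity; as the diagonal is real, it descends to R because the embedding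
    of polynomials is injective. *)
Lemma real_symmetric_diagonalization : A^T = A ->
  exists (P : 'M[R[i]]_n) (r : 'I_n -> R),
  [/\ P \is unitarymx,
      map_mx (real_complex R) A =
        P ^t* *m diag_mx (\row_i (real_complex R) (r i)) *m P
    & char_poly A = \prod_i ('X - (r i)%:P)].
Proof.
move=> A_sym; set AC := map_mx _ A.
have AC_herm : AC \is hermsymmx.
  apply: realsym_hermsym; last first.
    by apply/mxOverP => i j; rewrite mxE complex_real.
  apply/is_hermitianmxP; rewrite expr0 scale1r map_mx_id //; apply/matrixP => i j.
  by rewrite !mxE -[in LHS]A_sym mxE.
have /orthomx_spectralP defAC := hermitian_normalmx AC_herm.
have /mxOverP D_real := hermitian_spectral_diag_real AC_herm.
have Pun := spectral_unitarymx AC.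
pose r i := complex.Re (spectral_diag AC 0 i).
have defD : spectral_diag AC = \row_i (real_complex R) (r i).
  by apply/rowP => i; rewrite mxE /r RRe_real.
exists (spectralmx AC), r; split => //.
  by rewrite -defD -invmx_unitary.
apply: (@map_poly_inj _ _ (real_complex R)).
rewrite map_char_poly -/AC {1}defAC char_poly_similar ?spectral_unit //.
rewrite char_poly_trig ?diag_mx_is_trig // rmorph_prod; apply: eq_bigr => i _ /=.
by rewrite map_polyXsubC defD !mxE eqxx mulr1n.
Qed.

(** Counting roots with multiplicity is counting diagonal entries: group the
    indices i by the value r i, which always lies in the spectrum. *)
Lemma sum_mup_spectrum (r : 'I_n -> R) (p : pred R) :
    char_poly A = \prod_i ('X - (r i)%:P) ->
  \sum_(x <- spectrum A | p x) mup x (char_poly A) = #|[set i | p (r i)]|.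
Proof.
move=> defA; have Er : char_poly A = \prod_(y <- map r (enum 'I_n)) ('X - y%:P).
  by rewrite big_map big_enum.
have memr i : r i \in spectrum A.
  by rewrite mem_spectrum eigenvalue_root_char Er root_prod_XsubC map_f // mem_enum.
have mupE x : mup x (char_poly A) = (\sum_(i | r i == x) 1)%N.
  by rewrite Er mu_prod_XsubC count_map -sum1_count big_enum_cond.
under eq_bigr do rewrite mupE.
rewrite (exchange_big_dep (fun i => p (r i))) => [|x i px /eqP->] //=.
rewrite -sum1_card big_mkcond [RHS]big_mkcond; apply: eq_bigr => i _.
rewrite inE; case: ifP => // pri.
rewrite sum1_count (@eq_count _ _ (pred1 (r i))) => [|x /=].
  by rewrite count_uniq_mem ?spectrum_uniq // memr.
by rewrite eq_sym; case: eqP => [->|]; rewrite ?pri ?andbF.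
Qed.

End RealSymmetric.

(** * Graphs *)

(** The instance S = set0 gives k <= #|V|, so that the integer difference is the
    truncated one and the maximum can be bounded set by set. *)
Lemma alpha_le_sub (V : finType) (e : rel V) (d k : nat) :
    (forall S : {set V}, (induced_max_degree e S <= d)%N -> (k + #|S| <= #|V|)%N) ->
  (alpha e d)%:Z <= (#|V|)%:Z - k%:Z.
Proof.
move=> boundS; have le_kV : (k <= #|V|)%N.
  rewrite -[k]addn0 -(cards0 V) boundS //.
  by rewrite /induced_max_degree big_set0.
rewrite subzn // lez_nat; apply/bigmax_leqP => S /boundS.
by rewrite leq_subRL.
Qed.

Lemma card_support_le_degree (R : nzRingType) (V : finType) (e : rel V) (A : 'M[R]_(#|V|))
    (S : {set V}) (u : V) :
    (forall u v : V, ~~ e u v -> A (enum_rank u) (enum_rank v) = 0) ->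
  (#|[set j in enum_rank @: S | A (enum_rank u) j != 0%R]|
     <= induced_degree e S u)%N.
Proof.
move=> A_nonadj.
rewrite /induced_degree -(card_imset [set v in S | e u v] enum_rank_inj) subset_leq_card //.
apply/subsetP => j; rewrite inE => /andP[/imsetP[v vS ->] Auv].
by apply: imset_f; rewrite inE vS; apply: contraNT Auv => /A_nonadj ->.
Qed.

Theorem theorem13 (R : realType) (d : nat) (V : finType) (e : rel V)
    (e_sym : symmetric e) (e_irr : irreflexive e)
    (A : 'M[R]_(#|V|))
    (A_sym : A^T = A)
    (A_le1 : forall u v : V, `|A (enum_rank u) (enum_rank v)| <= 1)
    (A_nonadj : forall u v : V, ~~ e u v ->
       A (enum_rank u) (enum_rank v) = 0) :
  (alpha e d)%:Z <=
    Num.min ((#|V|)%:Z - (num_eig_gt d A)%:Z) ((#|V|)%:Z - (num_eig_ltN d A)%:Z).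
Proof.
have [P [r [Pun defA char_A]]] := real_symmetric_diagonalization A_sym.
set AC := map_mx _ A in defA.
have form_bound (S : {set V}) (x : 'rV[R[i]]_(#|V|)) :
    (induced_max_degree e S <= d)%N ->
    (forall i, i \notin enum_rank @: S -> x 0 i = 0) ->
  `|hform AC x| <= d%:R * hform 1%:M x.
  move=> /bigmax_leqP degS; apply: hform_norm_le => [i j|i j|i].
  - by rewrite !mxE -[in LHS]A_sym mxE.
  - rewrite mxE -(enum_valK i) -(enum_valK j) normc_def /= expr0n addr0 sqrtr_sqr.
    by rewrite lecR.
  case/imsetP => u uS ->; apply: leq_trans (degS u uS).
  apply: leq_trans (card_support_le_degree S u A_nonadj).
  by apply/subset_leq_card/subsetP => j; rewrite !inE mxE fmorph_eq0.
rewrite le_min; apply/andP; split; apply: alpha_le_sub => S degS;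
  rewrite -(card_imset (mem S) enum_rank_inj) /num_eig_gt /num_eig_ltN.
- rewrite (sum_mup_spectrum (fun x => d%:R < x) char_A).
  apply: card_big_eigenvalues_le Pun defA (ler0n _ d) _ _ => [i|x xS].
    by rewrite inE mxE -(rmorph_nat (real_complex R)) ltcR.
  exact: form_bound xS.
rewrite (sum_mup_spectrum (fun x => x < - d%:R) char_A).
have defAN : - AC = P ^t* *m diag_mx (- \row_i (real_complex R) (r i)) *m P.
  by rewrite defA linearN /= mulmxN mulNmx.
apply: card_big_eigenvalues_le Pun defAN (ler0n _ d) _ _ => [i|x xS].
  by rewrite inE !mxE -(rmorph_nat (real_complex R)) -rmorphN ltcR ltrNr.
by rewrite hformN normrN (form_bound S).
Qed.
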